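(* Let $t\ge 3$ and let $\mathcal{O}$ be an abstract object in the class $\mathcal{C}_t$. There is no obstruction-free perfect HI (linearizable, deterministic) implementation of $\mathcal{O}$, for $n\geq 2$ processes, from base objects each of which has fewer than $t$ states.
   Context: **Model.** An abstract object is a tuple $(Q,q_0,O,R,\Delta)$: states, initial state, operations, responses, and a deterministic sequential specification $\Delta:Q\times O\to Q\times R$; all states are reachable from $q_0$. Asynchronous processes $p_1,\dots,p_n$ communicate through finitely many shared base objects $obj_1,\dots,obj_m$ with state spaces $Q_1,\dots,Q_m$ (arbitrary atomic object types). A (deterministic) implementation gives each process a program for each operation in $O$; after an invocation the process takes steps, each consisting of local computation and one atomic primitive operation on a base object, and may eventually return a response. Each process has at most one pending operation at a time. A configuration gives the local state of each process and the state of each base object; the initial configuration is unique. An execution is an alternating sequence of configurations and steps from the initial configuration. For a finite execution $\alpha$, $\mathrm{mem}(\alpha)\in Q_1\times\dots\times Q_m$ is the vector of base-object states (not local states) in its last configuration. $H(\alpha)$ is the sequence of invocations and responses of high-level operations in $\alpha$. **Linearizability.** A completion of $H(\alpha)$ appends responses to zero or more pending operations. A linearization of $\alpha$ is a sequential history that is a permutation of a completion of $H(\alpha)$ (pending operations without responses being dropped), matches the sequential specification, and respects the real-time order of non-overlapping operations. A linearization function $h$ maps each execution $\alpha$ to a linearization $h(\alpha)$. For a sequential history $H$, $\mathrm{state}(H)$ is the state reached by applying its operations in order from $q_0$. **Perfect HI.** An implementation is perfect HI if for some linearization function $h$, for all finite executions $\alpha,\alpha'$ with $\mathrm{state}(h(\alpha))=\mathrm{state}(h(\alpha'))$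 we have $\mathrm{mem}(\alpha)=\mathrm{mem}(\alpha')$. **Obstruction-freedom.** A pending operation by $p_i$ returns within a finite number of steps of $p_i$ if $p_i$ runs solo. **Class $\mathcal{C}_t$ ($t\ge2$).** $\mathcal{O}\in\mathcal{C}_t$ if $Q$ can be partitioned into $t$ nonempty subsets $X_1,\dots,X_t$ such that: (i) there is an operation $o_{read}$ that never changes the state, such that for all $q_i\in X_i$, $q_j\in X_j$ with $i\ne j$, the responses to $o_{read}$ from $q_i$ and from $q_j$ differ; (ii) for any two states $q\ne q'$ in $Q$ there is an operation $o_{change}(q,q')$ that causes the object to transition from $q$ to $q'$. *)

(* Defs.v *)
From mathcomp Require Import all_boot.
From Stdlib Require List.

Set Implicit Arguments.
Unset Strict Implicit.
Unset Printing Implicit Defensive.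

(* A tuple (Q, q0, O, R, Delta).  Reachability of all states, which is part of
   the notion of an abstract object, is the separate predicate [all_reachable],
   so that the same record also serves for the atomic base objects. *)
Record object := Object {
  state : Type;
  init : state;
  op : Type;
  resp : Type;
  delta : state -> op -> state * resp
}.

Definition apply_ops (O : object) (q : state O) (s : seq (op O)) : state O :=
  foldl (fun q o => (delta q o).1) q s.

Definition all_reachable (O : object) : Prop :=
  forall q : state O, exists s : seq (op O), apply_ops (init O) s = q.

Definition in_class (t : nat) (O : object) : Prop :=
  exists X : 'I_t -> state O -> Prop,
    [/\ (* X is a partition of the states into nonempty parts *)
        [/\ forall i, exists q, X i q,
            forall q, exists i, X i q
          & forall i j q, X i q -> X j q -> i = j],
        exists o_read : op O,
          (forall q, (delta q o_read).1 = q) /\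
          (forall i j qi qj, i != j -> X i qi -> X j qj ->
             (delta qi o_read).2 <> (delta qj o_read).2)
      & forall q q' : state O, q <> q' ->
          exists o_change : op O, (delta q o_change).1 = q'].

Definition has_fewer_states (O : object) (t : nat) : Prop :=
  exists k : nat, k < t /\ exists f : state O -> 'I_k, bijective f.

(* What a process with a pending operation does next: apply the primitive [p]
   to base object [j] and continue according to its response, or return [r].
   [A] and [I] are its local states while an operation is, resp. is not,
   pending. *)
Inductive action (m : nat) (base : 'I_m -> object) (R A I : Type) :=
| Access (j : 'I_m) (p : op (base j)) (k : resp (base j) -> A)
| Return (r : R) (s : I).
Arguments Access {m base R A I} j p k.
Arguments Return {m base R A I} r s.

(* Deterministic implementation for [n] processes.  A process may keep local
   information between its operations, hence the states [idle]; the program of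
   process [i] for [o] starts in [invoke s o] and is then driven by [next]. *)
Record implementation (O : object) (n : nat) := Implementation {
  nobj : nat;
  base : 'I_nobj -> object;
  idle : 'I_n -> Type;
  active : 'I_n -> Type;
  idle0 : forall i, idle i;
  invoke : forall i, idle i -> op O -> active i;
  next : forall i, active i -> action base (resp O) (active i) (idle i)
}.

(* [Step i] is an access of process [i] to a base object; which one, and with
   which outcome, is determined by the configuration. *)
Inductive event (O : object) (n : nat) :=
| Invoke (i : 'I_n) (o : op O)
| Step (i : 'I_n)
| Respond (i : 'I_n) (r : resp O).
Arguments Step {O n} i.

Section Events.
Variables (O : object) (n : nat).

Definition proc (e : event O n) : 'I_n :=
  match e with Invoke i _ => i | Step i => i | Respond i _ => i end.

Definition high_level (e : event O n) : bool :=
  if e is Step _ then false else true.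

(* Histories are sequences of events without [Step]s. *)
Definition history : Type := seq (event O n).

Definition pending_in (H : history) (i : 'I_n) : Prop :=
  exists k o, onth H k = Some (Invoke i o) /\
    forall l e, k < l -> onth H l = Some e -> proc e != i.

Definition completion (H H' : history) : Prop :=
  exists s : seq ('I_n * resp O),
    [/\ uniq (unzip1 s),
        forall i, i \in unzip1 s -> pending_in H i
      & H' = H ++ [seq Respond x.1 x.2 | x <- s]].

(* A completed operation of a history, located by the positions of its
   invocation and of its response. *)
Record operation := Operation {
  op_proc : 'I_n;
  op_name : op O;
  op_resp : resp O;
  inv_pos : nat;
  res_pos : nat
}.

Definition operation_of (H : history) (x : operation) : Prop :=
  [/\ inv_pos x < res_pos x,
      onth H (inv_pos x) = Some (Invoke (op_proc x) (op_name x)),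
      onth H (res_pos x) = Some (Respond (op_proc x) (op_resp x))
    & forall l e, inv_pos x < l < res_pos x ->
        onth H l = Some e -> proc e != op_proc x].

(* In a sequential history every invocation is immediately followed by its
   response; such a pair is a triple (process, operation, response). *)
Definition seq_history : Type := seq ('I_n * op O * resp O).

Definition label (x : operation) : 'I_n * op O * resp O :=
  (op_proc x, op_name x, op_resp x).

Fixpoint legal_from (q : state O) (S : seq_history) : Prop :=
  match S with
  | [::] => True
  | (_, o, r) :: S' => (delta q o).2 = r /\ legal_from (delta q o).1 S'
  end.

Definition state_of (S : seq_history) : state O :=
  apply_ops (init O) [seq x.1.2 | x <- S].

(* The list [l] orders the completed operations of a completion [H'] of [H];
   no operation is placed before one that had returned prior to its
   invocation. *)
Definition linearization (H : history) (S : seq_history) : Prop :=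
  exists (H' : history) (l : seq operation),
    [/\ completion H H',
        List.NoDup l /\ (forall x, List.In x l <-> operation_of H' x),
        S = [seq label x | x <- l],
        legal_from (init O) S
      & pairwise (fun x y => ~~ (res_pos y < inv_pos x)) l].

End Events.

Section Executions.
Variables (O : object) (n : nat) (I : implementation O n).

Definition local_state (i : 'I_n) : Type := (idle I i + active I i)%type.
Definition memory : Type := forall j : 'I_(nobj I), state (base j).

Record config := Config {
  local : forall i, local_state i;
  mem : memory
}.

Definition config0 : config :=
  Config (fun i => inl (idle0 I i)) (fun j => init (base j)).

Definition pending (c : config) (i : 'I_n) : Prop :=
  exists a : active I i, local c i = inr a.

Inductive trans (c : config) : event O n -> config -> Prop :=
| TransInvoke i o s :
    local c i = inl s ->
    trans c (Invoke i o)
      (Config (dfwith (local c) (inr (invoke s o) : local_state i)) (mem c))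
| TransStep i a (j : 'I_(nobj I)) (p : op (base j)) k :
    local c i = inr a ->
    next a = Access j p k ->
    trans c (Step i)
      (Config
         (dfwith (local c) (inr (k (delta (mem c j) p).2) : local_state i))
         (dfwith (mem c) (delta (mem c j) p).1))
| TransRespond i a r s :
    local c i = inr a ->
    next a = Return r s ->
    trans c (Respond i r)
      (Config (dfwith (local c) (inl s : local_state i)) (mem c)).

(* A finite execution, given by the events and the configurations they lead
   to; the initial configuration is left implicit. *)
Definition trace : Type := seq (event O n * config).

Fixpoint execution_from (c : config) (alpha : trace) : Prop :=
  match alpha with
  | [::] => True
  | (e, c') :: alpha' => trans c e c' /\ execution_from c' alpha'
  end.

Definition execution (alpha : trace) : Prop := execution_from config0 alpha.

Definition last_config (alpha : trace) : config := last config0 (unzip2 alpha).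

Definition mem_of (alpha : trace) : memory := mem (last_config alpha).

Definition history_of (alpha : trace) : history O n :=
  [seq e <- unzip1 alpha | high_level e].

Definition linearization_function (h : trace -> seq_history O n) : Prop :=
  forall alpha, execution alpha -> linearization (history_of alpha) (h alpha).

Definition linearizable : Prop :=
  exists h : trace -> seq_history O n, linearization_function h.

Definition perfect_HI : Prop :=
  exists h : trace -> seq_history O n, linearization_function h /\
    forall alpha alpha', execution alpha -> execution alpha' ->
      state_of (h alpha) = state_of (h alpha') -> mem_of alpha = mem_of alpha'.

(* Programs are deterministic and a pending process can always move, so up to
   the response of [i] its solo run from a given configuration is unique. *)
Definition obstruction_free : Prop :=
  forall alpha i, execution alpha -> pending (last_config alpha) i ->
    exists (beta : trace) (r : resp O) (c : config),
      execution (alpha ++ rcons beta (Respond i r, c)) /\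
      all (fun x => proc x.1 == i) beta.

End Executions.

(* Main.v *)
(** Every state [q] is reached by an execution in which one process runs alone,
    and perfect HI makes the final memory of that execution a function [can q].
    When the process then moves the object from [q] to [q'], every prefix
    linearizes to state [q] or [q'], so the memory is always [can q] or
    [can q']; as a step changes one base object, [can q] and [can q'] differ in
    at most one base object.  They do differ if [q] and [q'] lie in different
    parts, since a second process, still in its initial local state, can tell
    them apart by running [o_read].  So [t] representatives of the parts give
    [t] memories at pairwise Hamming distance one: these all differ in the same
    base object, which therefore has at least [t] states. *)
Require Import Defs.
From mathcomp Require Import all_boot.
From mathcomp Require Import zify.
From Stdlib Require List.

Set Implicit Arguments.
Unset Strict Implicit.
Unset Printing Implicit Defensive.

(** * Linearizations of histories without overlapping operations *)

Section SequentialHistories.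
Variables (O : object) (n : nat).
Implicit Types (L S : seq_history O n) (H T : history O n) (p : 'I_n).

(** The executions considered below run one operation at a time, so their histories have this form,
    up to one operation still in progress at the end. *)
Fixpoint hist L : history O n :=
  if L is x :: L' then
    [:: Invoke x.1.1 x.1.2, Respond x.1.1 x.2 & hist L']
  else [::].

Lemma hist_rcons L x :
  hist (rcons L x) = hist L ++ [:: Invoke x.1.1 x.1.2; Respond x.1.1 x.2].
Proof. by elim: L => //= y L ->. Qed.

Lemma size_hist L : size (hist L) = (size L).*2.
Proof. by elim: L => //= y L ->. Qed.

Lemma onth_hist_even L k :
  onth (hist L) k.*2 = omap (fun x => Invoke x.1.1 x.1.2) (onth L k).
Proof. by elim: L k => [|y L IHL] [|k] //=; rewrite -IHL. Qed.

Lemma onth_hist_odd L k :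
  onth (hist L) k.*2.+1 = omap (fun x => Respond x.1.1 x.2) (onth L k).
Proof. by elim: L k => [|y L IHL] [|k] //=; rewrite -IHL. Qed.

Lemma onth_hist_Invoke L j p o : onth (hist L) j = Some (Invoke p o) ->
  exists k r, j = k.*2 /\ onth L k = Some (p, o, r).
Proof.
rewrite -(odd_double_half j); case: (odd j).
  by rewrite add1n onth_hist_odd; case: onth.
rewrite add0n onth_hist_even.
case E: onth => [[[p' o'] r]|] //= [<- <-].
by exists j./2, r.
Qed.

Lemma onth_lt (T : Type) (s : seq T) k x : onth s k = Some x -> k < size s.
Proof. by rewrite -onthTE => ->. Qed.

Lemma onth_catl (T : Type) (s1 s2 : seq T) k :
  k < size s1 -> onth (s1 ++ s2) k = onth s1 k.
Proof. by rewrite onth_cat => ->. Qed.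

Lemma pending_in_hist L T p : pending_in (hist L ++ T) p ->
  exists k o, onth T k = Some (Invoke p o).
Proof.
case=> k [o [Hk Hlater]]; move: Hk; rewrite onth_cat.
case: ltnP => [_|_ Hk]; last by exists (k - size (hist L)), o.
case/onth_hist_Invoke=> j [r [Ek Hj]].
have /(_ (Respond p r)) := Hlater k.+1 _ (ltnSn k).
rewrite Ek onth_catl; last first.
  by rewrite size_hist; have := onth_lt Hj; lia.
by rewrite onth_hist_odd Hj /= eqxx => /(_ erefl).
Qed.

(** With at most one event in [T], an operation invoked in [T] cannot also respond there, so its
    invocation lies in [hist L]. The matching response comes right after it, and no event of the
    same process may intervene. *)
Lemma operation_of_hist L T x : size T <= 1 ->
  operation_of (hist L ++ T) x ->
  exists k, [/\ inv_pos x = k.*2, res_pos x = k.*2.+1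
              & onth L k = Some (label x)].
Proof.
move=> sT [Hlt Hi Hr Hb].
have ltr := onth_lt Hr; rewrite size_cat in ltr.
have lti : inv_pos x < size (hist L) by lia.
move: Hi; rewrite onth_catl // => /onth_hist_Invoke[k [r [Ei Hk]]].
have ltk := onth_lt Hk.
have Hodd : onth (hist L ++ T) k.*2.+1 = Some (Respond (op_proc x) r).
  by rewrite onth_catl ?onth_hist_odd ?Hk // size_hist; lia.
have Er : res_pos x = k.*2.+1.
  apply/eqP; case: ltngtP => // [|gtr]; first by lia.
  have Hin : inv_pos x < k.*2.+1 < res_pos x by lia.
  by have := Hb _ _ Hin Hodd; rewrite eqxx.
exists k; split=> //; rewrite Hk.
by move: Hr; rewrite Er Hodd => -[->].
Qed.

Lemma hist_operation_of L T k y : onth L k = Some y ->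
  exists x, operation_of (hist L ++ T) x /\ inv_pos x = k.*2.
Proof.
move=> Hk; have ltk := onth_lt Hk.
exists (Operation y.1.1 y.1.2 y.2 k.*2 k.*2.+1); split=> //; split.
- exact: ltnSn.
- by rewrite onth_catl ?onth_hist_even ?Hk // size_hist /=; lia.
- by rewrite onth_catl ?onth_hist_odd ?Hk // size_hist /=; lia.
- by move=> l e /=; lia.
Qed.

Lemma operation_ext (x y : operation O n) :
  inv_pos x = inv_pos y -> res_pos x = res_pos y -> label x = label y -> x = y.
Proof.
by case: x => px ox rx ix jx; case: y => py oy ry iy jy /= -> -> [-> -> ->].
Qed.

(** Operations that do not overlap are totally ordered by real time, which leaves a single
    admissible order. In the proof [key] gives the index of an operation in [L]; the keys of [l] are
    shown to be [0, 1, ..., size L - 1] in this order. *)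
Lemma operations_hist L T (l : seq (operation O n)) : size T <= 1 ->
  List.NoDup l -> (forall x, List.In x l <-> operation_of (hist L ++ T) x) ->
  pairwise (fun x y => ~~ (res_pos y < inv_pos x)) l ->
  [seq label x | x <- l] = L.
Proof.
move=> sT Hnd Hin Hpw.
have Some_inj : injective (@Some ('I_n * op O * resp O)) by move=> ? ? [].
pose key (x : operation O n) := (inv_pos x)./2.
have Hop x : List.In x l -> [/\ inv_pos x = (key x).*2,
    res_pos x = (key x).*2.+1 & onth L (key x) = Some (label x)].
  move=> /Hin/(operation_of_hist sT)[k [Ei Er Hk]].
  by rewrite /key Ei doubleK.
have key_inj x y : List.In x l -> List.In y l -> key x = key y -> x = y.
  move=> /Hop[xi xr xl] /Hop[yi yr yl] E.
  by apply: operation_ext; [rewrite xi yi E|rewrite xr yr E|apply: Some_inj; rewrite -xl -yl E].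
(* The real-time condition only makes the keys weakly increasing; strictness comes from [NoDup] and
   [key_inj]. *)
have Hsorted : sorted ltn (map key l).
  rewrite sorted_pairwise; last exact: ltn_trans.
  move: Hnd Hpw Hop key_inj; clear.
  elim: l => //= x l IHl Hnd /andP[Hx Hpw] Hop key_inj.
  have [Hxl Hnd'] : ~ List.In x l /\ List.NoDup l by inversion Hnd.
  apply/andP; split; last first.
    apply: IHl => // [y Hy|y z Hy Hz]; first by apply: Hop; right.
    by apply: key_inj; right.
  have {}Hx : forall y, List.In y l -> ~~ (res_pos y < inv_pos x).
    move: Hx; clear; elim: l => //= y l IHl /andP[Hy Hl] z [<-|] //.
    exact: IHl.
  have Hlt y : List.In y l -> key x < key y.
    move=> Hy; have Hne : key x <> key y.
      by move=> E; apply: Hxl; rewrite (key_inj x y _ _ E) //; [left|right].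
    have [xi _ _] := Hop x (or_introl erefl).
    have [_ yr _] := Hop y (or_intror Hy).
    by have := Hx y Hy; lia.
  move: Hlt; clear; elim: l => //= y l IHl Hlt.
  by rewrite Hlt ?IHl //; [move=> z Hz; apply: Hlt; right|left].
have Hkeys : map key l = iota 0 (size L).
  apply: (irr_sorted_eq ltn_trans ltnn) => //; first exact: iota_ltn_sorted.
  move=> k; rewrite mem_iota add0n leq0n /=.
  apply/idP/idP.
    move=> Hk; suff [x /Hop[_ _ Hx] <-] : exists2 x, List.In x l & key x = k.
      exact: onth_lt Hx.
    move: Hk; clear; elim: l => //= x l IHl; rewrite in_cons.
    case/orP=> [/eqP->|/IHl[y Hy <-]]; first by exists x; [left|].
    by exists y; [right|].
  rewrite -onthTE; case Hk: onth => [y|] // _.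
  have [x [/Hin Hx Ex]] := hist_operation_of T Hk.
  have -> : k = key x by rewrite /key Ex doubleK.
  move: Hx; clear; elim: l => //= y l IHl [->|/IHl Hx]; rewrite in_cons.
    by rewrite eqxx.
  by rewrite Hx orbT.
apply: (inj_map Some_inj); rewrite -map_comp.
have -> : map Some L = map (onth L) (iota 0 (size L)).
  by clear; elim: L => //= x L IHL; rewrite IHL (iotaDl 1 0) -map_comp.
rewrite -Hkeys -map_comp.
move: Hop; clear; elim: l => //= x l IHl Hop.
rewrite IHl; last by move=> y Hy; apply: Hop; right.
by have [_ _ ->] := Hop x (or_introl erefl).
Qed.

Lemma linearization_hist L S :
  linearization (hist L) S -> S = L /\ legal_from (init O) L.
Proof.
case=> H' [l [[s [_ Hs EH]] [Hnd Hin] ES Hleg Hpw]].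
have Es : s = [::].
  case: s Hs {EH} => // -[p r] s /(_ p) /=; rewrite mem_head => /(_ isT).
  by rewrite -[hist L]cats0 => /pending_in_hist[[|k] [o]].
rewrite EH Es /= in Hin.
have E := operations_hist (T := [::]) isT Hnd Hin Hpw.
by rewrite ES E in Hleg *.
Qed.

(** A completion may drop the pending operation or append one response to it. The guessed response
    [r] is arbitrary, but the resulting state does not depend on it. *)
Lemma linearization_pending L S p o :
  linearization (hist L ++ [:: Invoke p o]) S ->
  S = L \/ exists r, S = rcons L (p, o, r).
Proof.
case=> H' [l [[s [Us Hs EH]] [Hnd Hin] -> _ Hpw]].
have {}Hs i : i \in unzip1 s -> i = p.
  by move/Hs=> /pending_in_hist[[|[|k]] [o']] //= [].
case: s Us Hs EH => [_ _|[p1 r] [_ Hs|[p2 r'] s]] /=.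
- rewrite cats0 => EH; left; rewrite EH in Hin.
  exact: (operations_hist _ Hnd Hin Hpw).
- rewrite (Hs p1 (mem_head _ _)) -catA /= => EH; right; exists r.
  have {}EH : H' = hist (rcons L (p, o, r)) ++ [::].
    by rewrite cats0 hist_rcons.
  by rewrite EH in Hin; apply: operations_hist Hin Hpw.
- move=> /andP[Hp _] Hs; move: Hp.
  have -> : p1 = p by apply: Hs; rewrite inE eqxx.
  have -> : p2 = p by apply: Hs; rewrite !inE eqxx orbT.
  by rewrite inE eqxx.
Qed.

Lemma legal_from_rcons q L x : legal_from q (rcons L x) ->
  (delta (apply_ops q [seq y.1.2 | y <- L]) x.1.2).2 = x.2.
Proof.
elim: L q => [|[[p o] r] L IHL] q /=; first by case: x => [[p o] r] /= [].
by case=> _ /IHL.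
Qed.

Lemma state_of_rcons L x : state_of (rcons L x) = (delta (state_of L) x.1.2).1.
Proof. by rewrite /state_of /apply_ops map_rcons foldl_rcons. Qed.

End SequentialHistories.

(** * Solo runs and their effect on the memory *)

Section Executions.
Variables (O : object) (n : nat) (I : implementation O n).
Implicit Types (c d : config I) (alpha path : trace I) (p i : 'I_n).

Definition solo p alpha : bool := all (fun x => proc x.1 == p) alpha.

Lemma execution_from_cat c alpha beta :
  execution_from c (alpha ++ beta) <->
  execution_from c alpha /\ execution_from (last c (unzip2 alpha)) beta.
Proof.
elim: alpha c => [|[e c'] alpha IH] c /=; first by split=> // -[].
by rewrite IH; split=> [[? []]|[[]]].
Qed.

Lemma last_config_cat alpha beta :
  last_config (alpha ++ beta) = last (last_config alpha) (unzip2 beta).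
Proof. by rewrite /last_config /unzip2 map_cat last_cat. Qed.

Lemma history_of_cat alpha beta :
  history_of (alpha ++ beta) = history_of alpha ++ history_of beta.
Proof. by rewrite /history_of /unzip1 map_cat filter_cat. Qed.

Lemma trans_local_other c e c' i :
  trans c e c' -> i != proc e -> local c' i = local c i.
Proof. by case=> * /=; rewrite dfwith_out // eq_sym. Qed.

Lemma solo_local_other c alpha p i :
  execution_from c alpha -> solo p alpha -> i != p ->
  local (last c (unzip2 alpha)) i = local c i.
Proof.
move=> + + Hi; elim: alpha c => //= -[e c'] alpha IH c [Ht Hx] /andP[/eqP /= Ep Hs].
by rewrite IH // (trans_local_other Ht) // Ep.
Qed.

Lemma trans_local_proc c e c' : trans c e c' ->
  match e with
  | Invoke i _ => exists s, local c i = inl s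
  | Step i => exists a, local c' i = inr a
  | Respond i _ => exists s, local c' i = inl s
  end.
Proof.
case=> [i o s E|i a j q k E1 E2|i a r s E1 E2] /=; first by exists s.
- by rewrite dfwith_in; eexists.
- by rewrite dfwith_in; eexists.
Qed.

(** A transition depends only on the memory and on the local state of the moving process. Memories
    are compared pointwise, so functional extensionality does not enter. *)
Lemma trans_replay c e c' d : trans c e c' ->
  local c (proc e) = local d (proc e) -> (forall j, Defs.mem c j = Defs.mem d j) ->
  exists d', [/\ trans d e d', local c' (proc e) = local d' (proc e)
               & forall j, Defs.mem c' j = Defs.mem d' j].
Proof.
case=> [i o s E|i a j q k E1 E2|i a r s E1 E2] /= El Em.
- eexists; split; first exact: TransInvoke (etrans (esym El) E).
    by rewrite /= !dfwith_in.
  exact: Em.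
- eexists; split; first exact: TransStep (etrans (esym El) E1) E2.
    by rewrite /= !dfwith_in Em.
  move=> j' /=; rewrite Em.
  have [->|Hj] := eqVneq j' j; first by rewrite !dfwith_in.
  by rewrite !dfwith_out // eq_sym.
- eexists; split; first exact: TransRespond (etrans (esym El) E1) E2.
    by rewrite /= !dfwith_in.
  exact: Em.
Qed.

Lemma solo_replay p c d alpha : execution_from c alpha -> solo p alpha ->
  local c p = local d p -> (forall j, Defs.mem c j = Defs.mem d j) ->
  exists beta, execution_from d beta /\ unzip1 beta = unzip1 alpha.
Proof.
elim: alpha c d => [|[e c'] alpha IH] c d /=; first by exists [::].
case=> Ht Hx /andP[/eqP /= Ep Hs] El Em; rewrite -Ep in El.
have [d' [Ht' El' Em']] := trans_replay Ht El Em; rewrite Ep in El'.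
have [beta [Hb Eb]] := IH _ _ Hx Hs El' Em'.
by exists ((e, d') :: beta); rewrite /= Eb.
Qed.

(** The run supplied by obstruction-freedom may contain earlier responses and new invocations by
    [p]. Cutting it at the first response leaves a single operation. *)
Lemma solo_first_response p c beta r c' : pending c p ->
  execution_from c (rcons beta (Respond p r, c')) -> solo p beta ->
  exists path r', [/\ execution_from c path, solo p path,
    history_of path = [:: Respond p r']
    & exists s, local (last c (unzip2 path)) p = inl s].
Proof.
elim: beta c => [|[e c1] beta IH] c Hp /=.
  case=> Ht _ _; exists [:: (Respond p r, c')], r.
  by split; rewrite //= ?eqxx //; apply: trans_local_proc Ht.
case=> Ht Hx /andP[/eqP /= Ep Hs].
case: e Ht Ep => [i o|i|i r1] Ht /= Ep; subst i.
- by have [s Es] := trans_local_proc Ht; case: Hp => a; rewrite Es.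
- have [path [r' [Hpx Hps Hh Hl]]] := IH _ (trans_local_proc Ht) Hx Hs.
  exists ((Step p, c1) :: path), r'.
  by split; rewrite //= ?eqxx.
- exists [:: (Respond p r1, c1)], r1.
  by split; rewrite //= ?eqxx //; apply: trans_local_proc Ht.
Qed.

Lemma solo_operation alpha p o s : obstruction_free I ->
  execution alpha -> local (last_config alpha) p = inl s ->
  exists path r, [/\ execution (alpha ++ path), solo p path,
    history_of path = [:: Invoke p o; Respond p r]
    & exists s', local (last_config (alpha ++ path)) p = inl s'].
Proof.
move=> OF Hx Es.
set c := last_config alpha in Es.
pose c1 := Config (dfwith (local c) (inr (invoke s o) : local_state I p)) (Defs.mem c).
have Ht : trans c (Invoke p o) c1 by apply: TransInvoke.
have Hx1 : execution (alpha ++ [:: (Invoke p o, c1)]).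
  by apply/execution_from_cat.
have El1 : last_config (alpha ++ [:: (Invoke p o, c1)]) = c1.
  by rewrite last_config_cat.
have Hp : pending c1 p by exists (invoke s o); rewrite /= dfwith_in.
have [|beta [r [c' [/execution_from_cat[_ Hb] Hs]]]] := OF _ p Hx1.
  by rewrite El1.
rewrite -/(last_config _) El1 in Hb.
have [path [r' [Hpx Hps Hh Hl]]] := solo_first_response Hp Hb Hs.
exists ((Invoke p o, c1) :: path), r'; split.
- by apply/execution_from_cat.
- by rewrite /= eqxx.
- by rewrite -Hh.
- by rewrite last_config_cat.
Qed.

(** The operations of [s] are run to completion one after another; that [p] ends idle allows the
    next invocation. *)
Lemma solo_reach (p : 'I_n) (s : seq (op O)) : obstruction_free I ->
  exists alpha (L : seq_history O n), [/\ execution alpha, solo p alpha,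
    history_of alpha = hist L, state_of L = apply_ops (init O) s
    & exists u, local (last_config alpha) p = inl u].
Proof.
move=> OF; elim/last_ind: s => [|s o [alpha [L [Hx Hs Hh Est [u Eu]]]]].
  by exists [::], [::]; split=> //; exists (idle0 I p).
have [path [r [Hpx Hps Hph Hpl]]] := solo_operation o OF Hx Eu.
exists (alpha ++ path), (rcons L (p, o, r)); split=> //.
- by rewrite /solo all_cat; apply/andP.
- by rewrite history_of_cat Hh Hph hist_rcons.
- by rewrite state_of_rcons Est /apply_ops foldl_rcons.
Qed.

(** Hamming distance at most one, phrased without counting because base-object states carry no
    decidable equality. *)
Definition differ_at_most_once (A B : memory I) : Prop :=
  forall j k, A j <> B j -> A k <> B k -> j = k.

Lemma trans_mem c e c' : trans c e c' -> differ_at_most_once (Defs.mem c) (Defs.mem c').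
Proof.
case=> [i o s _|i a j q k _ _|i a r s _ _] //= j1 j2.
have Hj k' : Defs.mem c k' <> dfwith (Defs.mem c) (delta (Defs.mem c j) q).1 k' -> k' = j.
  by have [//|/negPf Hk] := eqVneq k' j; rewrite dfwith_out // eq_sym Hk.
by move=> /Hj-> /Hj->.
Qed.

(** The first event after which the memory is no longer [A] takes it to [B] at once, and one event
    changes at most one base object. *)
Lemma execution_differ_at_most_once c alpha (A B : memory I) :
  execution_from c alpha -> Defs.mem c = A ->
  (forall k, let m := Defs.mem (last c (unzip2 (take k alpha))) in m = A \/ m = B) ->
  Defs.mem (last c (unzip2 alpha)) = B -> differ_at_most_once A B.
Proof.
elim: alpha c => [|[e c'] alpha IH] c /=; first by move=> _ <- _ <-.
case=> Ht Hx EA Hk EB.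
(* The prefix of length 1 gives the memory after the first event: if it is [B], that event suffices;
   if it is still [A], induction applies. *)
have := Hk 1; rewrite /= take0 /= => -[E|E]; last first.
  by rewrite -EA -E; apply: trans_mem Ht.
by apply: IH Hx E _ EB => k; have := Hk k.+1.
Qed.

Lemma history_of_take k alpha :
  exists k', history_of (take k alpha) = take k' (history_of alpha).
Proof.
exists (size (history_of (take k alpha))).
by rewrite -{3}[alpha](cat_take_drop k) history_of_cat take_size_cat.
Qed.

End Executions.

(** Points at pairwise Hamming distance one lie on a line parallel to an axis, here the [j]-th one.
    The last hypothesis stands in for excluded middle. *)
Lemma hamming_clique_collinear (m t : nat) (V : 'I_m -> Type)
    (M : 'I_t -> forall j, V j) :
  1 < t ->
  (forall a b, a != b -> exists j, M a j <> M b j) ->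
  (forall a b, a != b -> forall j k, M a j <> M b j -> M a k <> M b k -> j = k) ->
  (forall a b j, M a j = M b j \/ M a j <> M b j) ->
  exists j, injective (fun a => M a j).
Proof.
move=> ht Hdiff Hnear Hdec.
(* If [c] agreed with [b] at [j], they would differ at some other [k]. Both [c], [a] and [a], [b]
   differ at [j], hence agree at [k], so [c] and [b] agree at [k] after all. *)
have third a b c j : c != b -> M a j <> M b j -> M c j <> M b j.
  move=> Hcb Hab Ecb.
  have Hca : c != a by apply/eqP=> E; apply: Hab; rewrite -E.
  have Hba : a != b by apply/eqP=> E; apply: Hab; rewrite E.
  have [k Hk] := Hdiff _ _ Hcb.
  have Hjk : j <> k by move=> E; apply: Hk; rewrite -E.
  have Hac : M c j <> M a j by rewrite Ecb => E; apply: Hab.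
  have [E1|N1] := Hdec c a k; last exact: Hjk (Hnear _ _ Hca _ _ Hac N1).
  have [E2|N2] := Hdec a b k; last exact: Hjk (Hnear _ _ Hba _ _ Hab N2).
  by apply: Hk; rewrite E1.
pose i0 : 'I_t := Ordinal (ltnW ht); pose i1 : 'I_t := Ordinal ht.
have [j Hj] : exists j, M i0 j <> M i1 j by apply: Hdiff.
have Hi1 a : a != i1 -> M a j <> M i1 j by move=> Ha; apply: third Ha Hj.
exists j => a b /= E; apply/eqP/negPn/negP => Hab.
have [Ea|Na] := eqVneq a i1.
  by apply: (Hi1 b); [rewrite -Ea eq_sym | rewrite -E Ea].
have /(third _ _ b) : M i1 j <> M a j by move=> E1; apply: (Hi1 a Na).
by rewrite eq_sym => /(_ Hab); apply.
Qed.

Theorem proposition14 (t : nat) (ht : 3 <= t) (O : object)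
    (hreach : all_reachable O) (hO : in_class t O) (n : nat) (hn : 2 <= n) :
  ~ exists I : implementation O n,
      [/\ linearizable I,
          obstruction_free I,
          perfect_HI I
        & forall j : 'I_(nobj I), has_fewer_states (base j) t].
Proof.
move=> [I [_ OF [h [Hlin HI]] Hfew]].
have [X [[Xne _ Xdisj] [o_read [_ Hread]] Hchange]] := hO.
have [q Hq] := fin_all_exists Xne.
(* [p0] performs all state changes; [p1] is kept in its initial local state for the read. *)
pose p0 : 'I_n := Ordinal (ltnW hn); pose p1 : 'I_n := Ordinal hn.
have Hex i : exists aL : trace I * seq_history O n,
    [/\ execution aL.1, solo p0 aL.1, history_of aL.1 = hist aL.2,
        state_of aL.2 = q i & exists u, local (last_config aL.1) p0 = inl u].
  have [s Es] := hreach (q i).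
  have [alpha [L [H1 H2 H3 H4 H5]]] := solo_reach p0 s OF.
  by exists (alpha, L); split=> //=; rewrite -Es.
have [aL HaL] := fin_all_exists Hex.
(* [M i] is the canonical memory of the representative [q i]; [Mq] below shows that it does not
   depend on the chosen execution. *)
pose M i := mem_of (aL i).1.
have Hh alpha L : execution alpha -> history_of alpha = hist L ->
    h alpha = L /\ legal_from (init O) L.
  by move=> /Hlin + E; rewrite E => /linearization_hist.
have Mq i alpha : execution alpha -> state_of (h alpha) = q i ->
    mem_of alpha = M i.
  have [Hx _ Eh Est _] := HaL i.
  by move=> Hx' Est'; apply: HI => //; rewrite Est' (Hh _ _ Hx Eh).1.
(* Equality of base-object states is decided in ['I_k] through the bijection. *)
have Hdec (a b : 'I_t) j : M a j = M b j \/ M a j <> M b j.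
  have [k [_ [f /bij_inj f_inj]]] := Hfew j.
  by have [/f_inj|/eqP N] := eqVneq (f (M a j)) (f (M b j)); [left|right=> E; rewrite E in N].
have Hnear a b : a != b -> differ_at_most_once (M a) (M b).
  move=> Hab.
  have Nq : q a <> q b.
    by move=> E; move/eqP: Hab; apply; apply: Xdisj (Hq a) _; rewrite E.
  have [o Eo] := Hchange _ _ Nq.
  have [Hx _ Eh Est [u Eu]] := HaL a.
  have [path [r [Hpx _ Hph _]]] := solo_operation o OF Hx Eu.
  have [_ Hpath] := (execution_from_cat _ _ _).1 Hpx.
  have Emem : forall beta, Defs.mem (last (last_config (aL a).1) (unzip2 beta)) =
      mem_of ((aL a).1 ++ beta) by move=> beta; rewrite /mem_of last_config_cat.
  have Est' r' : state_of (rcons (aL a).2 (p0, o, r')) = q b.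
    by rewrite state_of_rcons Est.
  have Hfull alpha r' : execution alpha ->
      history_of alpha = hist (aL a).2 ++ [:: Invoke p0 o; Respond p0 r'] ->
      mem_of alpha = M b.
    move=> Hx' E; apply: Mq => //.
    have [|-> _] := Hh _ (rcons (aL a).2 (p0, o, r')) Hx'; last exact: Est'.
    by rewrite hist_rcons.
  apply: (execution_differ_at_most_once Hpath) => //; last first.
    by rewrite Emem; apply: (Hfull _ r) => //; rewrite history_of_cat Eh Hph.
  move=> k /=; rewrite Emem.
  have Hxk : execution ((aL a).1 ++ take k path).
    move: Hpx; rewrite -{1}(cat_take_drop k path) catA.
    by case/execution_from_cat.
  have [k' Ek] := history_of_take k path.
  have {}Ek : history_of ((aL a).1 ++ take k path) =
      hist (aL a).2 ++ take k' [:: Invoke p0 o; Respond p0 r].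
    by rewrite history_of_cat Eh Ek Hph.
  (* Before the invocation the state is [q a], after the response it is [q b]; in between it is
     either, according to whether the linearization includes the pending operation. *)
  case: k' Ek => [|[|k']] /= Ek.
  - left; apply: Mq => //.
    by rewrite cats0 in Ek; rewrite (Hh _ _ Hxk Ek).1.
  - have := Hlin _ Hxk; rewrite Ek => /linearization_pending[E|[r' E]].
      by left; apply: Mq => //; rewrite E.
    by right; apply: Mq => //; rewrite E.
  - by right; apply: (Hfull _ r).
have Hdiff a b : a != b -> ~ forall j, M a j = M b j.
  move=> Hab EM.
  have idle1 i : local (last_config (aL i).1) p1 = inl (idle0 I p1).
    by have [Hx Hs _ _ _] := HaL i; rewrite (solo_local_other Hx Hs).
  have [Hxa _ Eha Ea _] := HaL a; have [Hxb _ Ehb Eb _] := HaL b.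
  have [path [r [Hpx Hps Hph _]]] := solo_operation o_read OF Hxa (idle1 a).
  have [_ Hpath] := (execution_from_cat _ _ _).1 Hpx.
  (* With equal memories and [p1] in the same local state, the read replays event for event and
     returns the same [r] from both configurations. *)
  have [|path' [Hpath' Eev]] := @solo_replay _ _ _ p1 _ (last_config (aL b).1) _ Hpath Hps _ EM.
    by rewrite -/(last_config _) !idle1.
  have Hpx' : execution ((aL b).1 ++ path') by apply/execution_from_cat.
  have Hph' : history_of path' = [:: Invoke p1 o_read; Respond p1 r].
    by rewrite /history_of Eev.
  have Hresp i beta : execution ((aL i).1 ++ beta) ->
      history_of (aL i).1 = hist (aL i).2 -> state_of (aL i).2 = q i ->
      history_of beta = [:: Invoke p1 o_read; Respond p1 r] ->
      (delta (q i) o_read).2 = r.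
    move=> Hx Eh Est Ebeta.
    have [|_ /legal_from_rcons /=] := Hh _ (rcons (aL i).2 (p1, o_read, r)) Hx.
      by rewrite history_of_cat Eh Ebeta hist_rcons.
    by rewrite -/(state_of _) Est.
  apply: (Hread _ _ _ _ Hab (Hq a) (Hq b)).
  by rewrite (Hresp a path) // (Hresp b path').
have [|j M_inj] := @hamming_clique_collinear _ _ _ M (ltnW ht) _ Hnear Hdec.
  move=> a b Hab.
  (* Fixing bijections for all base objects at once makes the search for a differing coordinate a
     finite boolean one. *)
  have [g Hg] := fin_all_exists Hfew.
  have [f Hf] := fin_all_exists (fun j => (Hg j).2).
  case: (pickP (fun j => f j (M a j) != f j (M b j))) => [j /eqP N|E].
    by exists j => E; apply: N; rewrite E.
  by case: (Hdiff _ _ Hab) => j; apply: (bij_inj (Hf j)); apply/eqP/negbFE/E.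
have [k [ltk [f /bij_inj f_inj]]] := Hfew j.
(* Pigeonhole: this map injects ['I_t] into ['I_k], although [k < t]. *)
have := leq_card (fun a => f (M a j)) (fun a b E => M_inj a b (f_inj _ _ E)).
by rewrite !card_ord leqNgt ltk.
Qed.
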